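(* Let $k$ be an algebraically closed field of characteristic zero, let $G=\mathrm{Paut}(f)$ be the projective automorphism group of a nonsingular quartic form $f(x,y,z,t)\in k[x,y,z,t]$, and let $|G|=\prod_p p^{\nu(p)}$ be the decomposition of $|G|$ into prime factors. Then $\nu(5)\leq 1$.
   Context: A quartic form is a homogeneous polynomial of degree $4$; it is nonsingular if it is nonzero and the projective algebraic set $V_p(f)\subset\mathbf{P}^3(k)$ is nonsingular. For $A\in GL_4(k)$, $f_{A^{-1}}$ denotes the form $v\mapsto f(Av)$, $(A)$ is the class of $A$ in $PGL_4(k)$, and $\mathrm{Paut}(f)=\{(A)\in PGL_4(k): f_{A^{-1}}=cf \text{ for some } c\in k^*\}$; it is a finite group when $f$ is nonsingular of degree $\geq 3$. *)

(* Defs.v *)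
From HB Require Import structures.
From mathcomp Require Import all_boot all_order all_algebra.
From mathcomp Require Import finmap.
From mathcomp Require Import mpoly.

Set Implicit Arguments.
Unset Strict Implicit.
Unset Printing Implicit Defensive.

Import GRing.Theory.
Local Open Scope ring_scope.
Local Open Scope quotient_scope.

(* {unit 'M[k]_n} is only available for finite k, hence this GL_n(k) and its
   quotient PGL_n(k), both as (possibly infinite) groupTypes. *)
Section ProjectiveLinearGroup.
Variables (k : fieldType) (n : nat).

Record GL := MkGL { GLmx :> 'M[k]_n; GLmx_unit : GLmx \in unitmx }.

HB.instance Definition _ := [isSub for GLmx].
HB.instance Definition _ := [Choice of GL by <:].

Fact GL1_subproof : (1%:M : 'M[k]_n) \in unitmx.
Proof. exact: unitmx1. Qed.
Fact GLV_subproof (A : GL) : invmx A \in unitmx.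
Proof. by rewrite unitmx_inv GLmx_unit. Qed.
Fact GLM_subproof (A B : GL) : A *m B \in unitmx.
Proof. by rewrite unitmx_mul !GLmx_unit. Qed.

Definition GL_one := MkGL GL1_subproof.
Definition GL_inv (A : GL) := MkGL (GLV_subproof A).
Definition GL_mul (A B : GL) := MkGL (GLM_subproof A B).

Fact GL_mulA : associative GL_mul.
Proof. by move=> A B C; apply: val_inj; rewrite /= mulmxA. Qed.
Fact GL_mul1 : left_id GL_one GL_mul.
Proof. by move=> A; apply: val_inj; rewrite /= mul1mx. Qed.
Fact GL_mulr1 : right_id GL_one GL_mul.
Proof. by move=> A; apply: val_inj; rewrite /= mulmx1. Qed.
Fact GL_mulV : left_inverse GL_one GL_inv GL_mul.
Proof. by move=> A; apply: val_inj; rewrite /= mulVmx ?GLmx_unit. Qed.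
Fact GL_mulrV : right_inverse GL_one GL_inv GL_mul.
Proof. by move=> A; apply: val_inj; rewrite /= mulmxV ?GLmx_unit. Qed.

HB.instance Definition _ :=
  isGroup.Build GL GL_mulA GL_mul1 GL_mulr1 GL_mulV GL_mulrV.

Definition GL_eqv (A B : GL) : bool := is_scalar_mx (A *m invmx B).

Lemma GL_eqvP (A B : GL) :
  reflect (exists2 c : k, c != 0 & (A : 'M_n) = c *: (B : 'M_n)) (GL_eqv A B).
Proof.
apply: (iffP is_scalar_mxP) => [[c def_c]|[c nz_c def_A]]; last first.
  by exists c; rewrite def_A -scalemxAl mulmxV ?GLmx_unit ?scalemx1.
have def_A : (A : 'M_n) = c *: (B : 'M_n).
  by rewrite -mul_scalar_mx -def_c mulmxKV ?GLmx_unit.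
have [c0|nz_c] := eqVneq c 0; last by exists c.
have A0 : (A : 'M_n) = 0 by rewrite def_A c0 scale0r.
exists 1; rewrite ?oner_eq0 // scale1r A0.
by rewrite -[RHS](mulKVmx (GLmx_unit A)) A0 mul0mx.
Qed.

Fact GL_eqv_refl : reflexive GL_eqv.
Proof. by move=> A; apply/GL_eqvP; exists 1; rewrite ?oner_eq0 ?scale1r. Qed.
Fact GL_eqv_sym : ssrbool.symmetric GL_eqv.
Proof.
move=> A B; apply/GL_eqvP/GL_eqvP => -[c nz_c ->]; exists c^-1;
  by rewrite ?invr_eq0 // scalerA mulVf // scale1r.
Qed.
Fact GL_eqv_trans : transitive GL_eqv.
Proof.
move=> B A C /GL_eqvP[a nz_a eqAB] /GL_eqvP[b nz_b eqBC]; apply/GL_eqvP.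
by exists (a * b); rewrite ?mulf_neq0 // eqAB eqBC scalerA.
Qed.

Canonical GL_eqv_equiv :=
  EquivRel GL_eqv GL_eqv_refl GL_eqv_sym GL_eqv_trans.

Definition PGL := {eq_quot GL_eqv}.
HB.instance Definition _ := Choice.on PGL.
HB.instance Definition _ := EqQuotient.on PGL.

Definition PGL_class (A : GL) : PGL := \pi A.

Lemma PGL_classP (A B : GL) :
  PGL_class A = PGL_class B <->
  exists2 c : k, c != 0 & (A : 'M_n) = c *: (B : 'M_n).
Proof.
split=> [/eqquotP/GL_eqvP // | /GL_eqvP eqAB].
by apply/eqquotP.
Qed.

Definition PGL_one : PGL := PGL_class GL_one.
Definition PGL_inv (a : PGL) : PGL := PGL_class (GL_inv (repr a)).
Definition PGL_mul (a b : PGL) : PGL := PGL_class (GL_mul (repr a) (repr b)).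

Lemma PGL_class_ind (P : PGL -> Prop) :
  (forall A, P (PGL_class A)) -> forall a, P a.
Proof. by move=> PA a; rewrite -[a]reprK; apply: PA. Qed.

Lemma PGL_class_repr (A : GL) :
  exists2 c : k, c != 0 & (repr (PGL_class A) : 'M_n) = c *: (A : 'M_n).
Proof. by apply/PGL_classP; rewrite /PGL_class reprK. Qed.

Lemma PGL_classM (A B : GL) :
  PGL_class (GL_mul A B) = PGL_mul (PGL_class A) (PGL_class B).
Proof.
apply/esym/PGL_classP; rewrite /=.
have [a nz_a ->] := PGL_class_repr A; have [b nz_b ->] := PGL_class_repr B.
exists (a * b); first by rewrite mulf_neq0.
by rewrite -scalemxAl -scalemxAr scalerA.
Qed.

Lemma PGL_classV (A : GL) :
  PGL_class (GL_inv A) = PGL_inv (PGL_class A).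
Proof.
apply/esym/PGL_classP; rewrite /=; have [a nz_a ->] := PGL_class_repr A.
by exists a^-1; rewrite ?invr_eq0 // invmxZ // -mul_scalar_mx unitmx_mul
  GLmx_unit andbT unitmxE det_scalar unitrX ?unitfE.
Qed.

Fact PGL_mulA : associative PGL_mul.
Proof.
elim/PGL_class_ind=> A; elim/PGL_class_ind=> B; elim/PGL_class_ind=> C.
by rewrite -!PGL_classM GL_mulA.
Qed.
Fact PGL_mul1 : left_id PGL_one PGL_mul.
Proof. by elim/PGL_class_ind=> A; rewrite -PGL_classM GL_mul1. Qed.
Fact PGL_mulr1 : right_id PGL_one PGL_mul.
Proof. by elim/PGL_class_ind=> A; rewrite -PGL_classM GL_mulr1. Qed.
Fact PGL_mulV : left_inverse PGL_one PGL_inv PGL_mul.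
Proof.
by elim/PGL_class_ind=> A; rewrite -PGL_classV -PGL_classM GL_mulV.
Qed.
Fact PGL_mulrV : right_inverse PGL_one PGL_inv PGL_mul.
Proof.
by elim/PGL_class_ind=> A; rewrite -PGL_classV -PGL_classM GL_mulrV.
Qed.

HB.instance Definition _ :=
  isGroup.Build PGL PGL_mulA PGL_mul1 PGL_mulr1 PGL_mulV PGL_mulrV.

End ProjectiveLinearGroup.

Arguments PGL_class {k n} A.

Section Forms.
Variables (k : fieldType) (n : nat).
Implicit Types (f : {mpoly k[n]}) (A : 'M[k]_n) (v : 'cV[k]_n).

Definition form_eval f v : k := f.@[fun i => v i 0].

(* The form v |-> f (A v), written f_{A^-1} in the literature. *)
Definition form_subst f A : {mpoly k[n]} :=
  f \mPo [tuple \sum_j A i j *: 'X_j | i < n].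

Lemma form_substE f A v : form_eval (form_subst f A) v = form_eval f (A *m v).
Proof.
rewrite /form_eval /form_subst comp_mpoly_meval; apply: meval_eq => i.
rewrite tnth_map tnth_ord_tuple raddf_sum /= mxE; apply: eq_bigr => j _.
by rewrite mevalZ mevalXU.
Qed.

(* Points of the projective hypersurface f = 0 are represented by nonzero
   vectors.  The hypersurface is taken with the structure given by f (Jacobian
   criterion on f itself), so that e.g. the square of a nonsingular quadratic
   form is singular. *)
Definition nonsingular_form f : Prop :=
  f != 0 /\
  forall v, v != 0 -> form_eval f v = 0 ->
    exists i : 'I_n, form_eval f^`M(i) v != 0.

Definition Paut f (a : PGL k n) : Prop :=
  exists2 A : GL k n, a = PGL_class A &
    exists2 c : k, c != 0 & form_subst f A = c *: f.

Lemma form_subst1 f : form_subst f 1%:M = f.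
Proof.
rewrite /form_subst -[RHS]comp_mpoly_id; congr (_ \mPo _).
apply: eq_from_tnth => i; rewrite !tnth_mktuple (bigD1 i) //= big1 => [|j ne_ji].
  by rewrite mxE eqxx scale1r addr0.
by rewrite mxE eq_sym (negPf ne_ji) scale0r.
Qed.

Lemma form_substM f A B :
  form_subst f (A *m B) = form_subst (form_subst f A) B.
Proof.
rewrite {1}/form_subst -[RHS]/(form_subst f A \mPo _) [in RHS]/form_subst.
rewrite !(comp_mpolyE f) raddf_sum; apply: eq_bigr => m _ /=.
rewrite [RHS]comp_mpolyZ rmorph_prod; congr (_ *: _); apply: eq_bigr => i _.
rewrite rmorphXn !tnth_mktuple raddf_sum; congr (_ ^+ _) => /=.
under [RHS]eq_bigr do rewrite comp_mpolyZ comp_mpolyXU -tnth_nth tnth_mktuple scaler_sumr.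
rewrite exchange_big /=; apply: eq_bigr => j _; rewrite mxE scaler_suml.
by apply: eq_bigr => l _; rewrite scalerA.
Qed.

Lemma Paut1 f : Paut f 1%g.
Proof.
exists (GL_one k n) => //; exists 1; first exact: oner_neq0.
by rewrite form_subst1 scale1r.
Qed.

Lemma PautM f (a b : PGL k n) : Paut f a -> Paut f b -> Paut f (a * b)%g.
Proof.
move=> [A -> [c nz_c fA]] [B -> [d nz_d fB]].
exists (GL_mul A B); first by rewrite PGL_classM.
exists (c * d); first exact: mulf_neq0.
by rewrite form_substM fA /form_subst comp_mpolyZ -/(form_subst f B) fB scalerA.
Qed.

Lemma PautV f (a : PGL k n) : Paut f a -> Paut f (a^-1)%g.
Proof.
move=> [A -> [c nz_c fA]]; exists (GL_inv A); first by rewrite PGL_classV.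
exists c^-1; first by rewrite invr_eq0.
rewrite -[f in RHS]form_subst1 -(mulmxV (GLmx_unit A)) form_substM fA.
by rewrite /form_subst comp_mpolyZ scalerA mulVf // scale1r.
Qed.

End Forms.

(* Main.v *)
Require Import Defs.
From HB Require Import structures.
From mathcomp Require Import all_boot all_order all_algebra.
From mathcomp Require Import all_fingroup all_solvable separable cyclotomic.
From mathcomp Require Import finmap.
From mathcomp Require Import mpoly.

Set Implicit Arguments.
Unset Strict Implicit.
Unset Printing Implicit Defensive.

(* If 25 divides |G|, then G has an abelian subgroup of order 25.  Because 25 is
   prime to 4, its elements lift to matrices A with A^25 = 1 that preserve f
   itself, and the lifts commute: the commutator of two of them is a scalar c
   with c^4 = c^25 = 1.  Diagonalize all lifts simultaneously.  Smoothness of f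
   at the i-th coordinate point gives a monomial x_i^3 x_(s i) of f, so every
   lift diag(d) satisfies d_i^3 d_(s i) = 1, that is, d_(s i) = d_i^(-3).
   On a cycle of length l of the map s this forces d_i^((-3)^l - 1) = 1, where
   (-3)^l - 1 is prime to 5 for l < 4 and equals 80 for l = 4; an index off the
   cycles has d_i = 1 as soon as its images under s do, -3 being prime to 5.
   Hence either all the d_i are 1, or s is a 4-cycle and d is determined by a
   single d_i, with d_i^5 = 1.  So there are at most 5 lifts instead of 25. *)

Import GRing.Theory.

Local Open Scope ring_scope.

(** * Finite subgroups of a possibly infinite group *)

Section FiniteSubgroups.
Local Open Scope group_scope.
Variables (gT : groupType) (G : {fset gT}).
Hypothesis groupG : 1 \in G /\ {in G &, forall x y, x * y^-1 \in G}.

(* The unused argument keeps the closure proof in the type, so that the group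
   structure below can be inferred. *)
Definition fset_group of 1 \in G /\ {in G &, forall x y, x * y^-1 \in G} :=
  fset_sub_type G.
Local Notation T := (fset_group groupG).
HB.instance Definition _ := Finite.on T.

Fact fset_group1_subproof : 1 \in G. Proof. by case: groupG. Qed.
Fact fset_groupV_subproof (x : T) : (val x)^-1 \in G.
Proof. by case: groupG => G1 GD; rewrite -[_^-1]mul1g GD ?(valP x). Qed.
Fact fset_groupM_subproof (x y : T) : val x * val y \in G.
Proof.
case: groupG => _ GD; rewrite -[val y]invgK GD ?(valP x) //.
exact: fset_groupV_subproof.
Qed.

Definition fset_group_mul (x y : T) : T := FSetSub (fset_groupM_subproof x y).
Definition fset_group_one : T := FSetSub fset_group1_subproof.
Definition fset_group_inv (x : T) : T := FSetSub (fset_groupV_subproof x).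

Fact fset_group_mulA : associative fset_group_mul.
Proof. by move=> x y z; apply: val_inj; rewrite /= mulgA. Qed.
Fact fset_group_mul1 : left_id fset_group_one fset_group_mul.
Proof. by move=> x; apply: val_inj; rewrite /= mul1g. Qed.
Fact fset_group_mulV :
  left_inverse fset_group_one fset_group_inv fset_group_mul.
Proof. by move=> x; apply: val_inj; rewrite /= mulVg. Qed.

HB.instance Definition _ := Finite_isGroup.Build T
  fset_group_mulA fset_group_mul1 fset_group_mulV.

Lemma fset_group_valX (x : T) n : val (x ^+ n) = val x ^+ n.
Proof. by elim: n => // n IHn; rewrite !expgS /= IHn. Qed.

(** A Sylow [p]-subgroup has order at least [p ^ 2], hence a normal subgroup of order exactly
    [p ^ 2], and groups of that order are abelian. The answer is a sequence in [gT], so that later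
    arguments stay in the ambient group. *)
Lemma abelian_p2subgroup p : prime p -> (1 < logn p #|` G|)%N ->
  exists s : seq gT,
    [/\ uniq s, size s = (p ^ 2)%N, {subset s <= G},
        {in s &, forall x y, x * y = y * x} &
        {in s, forall x, x ^+ (p ^ 2) = 1}].
Proof.
move=> p_pr p2G; have [P sylP] := Sylow_exists p [set: T].
have pP : p.-group P by case/and3P: sylP.
have le2P : (2 <= logn p #|P|)%N.
  rewrite (card_Hall sylP) p_part pfactorK // cardsT.
  by move: p2G; rewrite cardfE.
have [H [_ _ cardH]] := normal_pgroup pP (normal_refl P) le2P.
have abH : abelian H by apply: card_p2group_abelian cardH.
exists [seq val x | x <- enum H]; split.
- by rewrite map_inj_uniq ?enum_uniq //; apply: val_inj.
- by rewrite size_map -cardE.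
- by move=> _ /mapP[x _ ->]; apply: valP.
- move=> _ _ /mapP[x + ->] /mapP[y + ->]; rewrite !mem_enum => xH yH.
  exact: (congr1 val (centsP abH x xH y yH)).
- move=> _ /mapP[x + ->]; rewrite mem_enum => xH.
  by rewrite -fset_group_valX -cardH expg_cardG.
Qed.

End FiniteSubgroups.

(** * Linear substitutions, derivatives and monomials of forms *)

Section Forms.
Variables (k : fieldType) (n : nat).
Implicit Types (f g : {mpoly k[n]}) (A P : 'M[k]_n) (m : 'X_{1..n}).

Lemma form_substZ c f A : form_subst (c *: f) A = c *: form_subst f A.
Proof. exact: comp_mpolyZ. Qed.

Lemma form_substD f g A :
  form_subst (f + g) A = form_subst f A + form_subst g A.
Proof. exact: comp_mpolyD. Qed.

Lemma form_subst_mul f g A :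
  form_subst (f * g) A = form_subst f A * form_subst g A.
Proof. exact: rmorphM. Qed.

Lemma mderivXU i j : ('X_i : {mpoly k[n]})^`M(j) = (i == j)%:R.
Proof.
rewrite mderivX mnm1E; have [->|_] := eqVneq i j; last by rewrite scale0r.
suff -> : (U_(j) - U_(j))%MM = 0%MM :> 'X_{1..n} by rewrite mpolyX0 scale1r.
by apply/mnmP=> l; rewrite mnmBE subnn mnm0E.
Qed.

(** The chain rule. Both sides are additive and obey the same Leibniz rule, so constants and
    variables are enough. *)
Lemma mderiv_form_subst f A l :
  (form_subst f A)^`M(l) = \sum_j A j l *: form_subst f^`M(j) A.
Proof.
pose P f := (form_subst f A)^`M(l) = \sum_j A j l *: form_subst f^`M(j) A.
have PC c : P c%:MP.
  rewrite /P /form_subst comp_mpolyC mderivC big1 // => j _.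
  by rewrite mderivC comp_mpoly0 scaler0.
have PM p q : P p -> P q -> P (p * q).
  rewrite /P form_subst_mul mderivM => -> ->.
  rewrite mulr_suml mulr_sumr -big_split; apply: eq_bigr => j _ /=.
  by rewrite mderivM form_substD !form_subst_mul scalerDr -scalerAl -scalerAr.
have PD p q : P p -> P q -> P (p + q).
  rewrite /P form_substD mderivD => -> ->.
  rewrite -big_split; apply: eq_bigr => j _ /=.
  by rewrite mderivD form_substD scalerDr.
have PX i : P 'X_i.
  rewrite /P /form_subst comp_mpolyXU -tnth_nth tnth_mktuple raddf_sum /=.
  rewrite (bigD1 l) //= big1 => [|j nlj]; last first.
    by rewrite mderivZ mderivXU (negPf nlj) scaler0.
  rewrite addr0 (bigD1 i) //= big1 => [|j nji]; last first.
    by rewrite mderivXU eq_sym (negPf nji) comp_mpoly0 scaler0.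
  by rewrite mderivZ !mderivXU !eqxx comp_mpoly1 addr0.
rewrite -/(P f); elim/mpolyind: f => [|c m p _ _ Pp]; first exact: (PC 0).
apply: (PD _ _ _ Pp); rewrite -mul_mpolyC; apply: (PM _ _ (PC c)).
rewrite mpolyXE_id; apply: (big_ind P) => [||i _].
- exact: (PC 1).
- exact: PM.
elim: (m i) => [|e Pe]; [exact: (PC 1) | rewrite exprS; apply: PM (PX i) Pe].
Qed.

(** By the chain rule the gradient of the new form at [v] is the row gradient of [f] at [P *m v]
    times [P]; as [P] is invertible, one vanishes only if the other does. *)
Lemma nonsingular_form_subst f P :
  P \in unitmx -> nonsingular_form f -> nonsingular_form (form_subst f P).
Proof.
move=> uP [nz_f smooth_f]; split.
  apply: contraNneq nz_f => fP0.
  rewrite -[f]form_subst1 -(mulmxV uP) form_substM fP0.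
  by rewrite /form_subst comp_mpoly0.
move=> v nz_v fPv0; have nz_Pv : P *m v != 0.
  by apply: contraNneq nz_v => Pv0; rewrite -(mulKmx uP v) Pv0 mulmx0.
rewrite form_substE in fPv0; have [j nz_dj] := smooth_f _ nz_Pv fPv0.
apply/existsP; apply: contraNT nz_dj; rewrite negb_exists => /forallP dv0.
pose w := \row_j form_eval f^`M(j) (P *m v).
suff w0 : w = 0 by move/rowP/(_ j): w0; rewrite !mxE => ->.
rewrite -(mulmxK uP w); suff -> : w *m P = 0 by rewrite mul0mx.
apply/rowP=> l; rewrite !mxE; move: (dv0 l); rewrite negbK => /eqP dl0.
rewrite -[RHS]dl0 mderiv_form_subst /form_eval raddf_sum.
apply: eq_bigr => i _ /=.
by rewrite mevalZ mxE -/(form_eval _ v) form_substE mulrC.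
Qed.

Lemma mcoeff_subst_diag f (d : 'rV[k]_n) m :
  (form_subst f (diag_mx d))@_m = (\prod_i d 0 i ^+ m i) * f@_m.
Proof.
have substX (m' : 'X_{1..n}) : form_subst 'X_[m'] (diag_mx d)
  = (\prod_i d 0 i ^+ m' i) *: 'X_[m'].
  rewrite /form_subst comp_mpolyX mpolyXE_id -scaler_prod.
  apply: eq_bigr => i _; rewrite tnth_mktuple (bigD1 i) //= big1 => [|j nji].
    by rewrite addr0 mxE eqxx mulr1n exprZn.
  by rewrite mxE eq_sym (negPf nji) mulr0n scale0r.
elim/mpolyind: f => [|c m' p _ _ IHp].
  by rewrite /form_subst comp_mpoly0 !mcoeff0 mulr0.
rewrite form_substD form_substZ substX !mcoeffD IHp mulrDr !mcoeffZ mcoeffX.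
congr (_ + _).
by have [->|_] := eqVneq m' m; rewrite ?mulr0 // !mulr1 mulrC.
Qed.

Lemma form_subst_scalar f d (c : k) :
  f \is d.-homog -> form_subst f c%:M = c ^+ d *: f.
Proof.
move=> hf; apply/mpolyP=> m.
rewrite -diag_const_mx mcoeff_subst_diag mcoeffZ.
have [<-|ne_md] := eqVneq (mdeg m) d; last first.
  by rewrite (dhomog_nemf_coeff hf ne_md) !mulr0.
by rewrite mdegE -prodrXr; congr (_ * _); apply: eq_bigr => i _; rewrite mxE.
Qed.

Lemma form_subst_homog f d A : f \is d.-homog -> form_subst f A \is d.-homog.
Proof.
move=> hf; rewrite /form_subst comp_mpolyE big_seq rpred_sum // => m mf.
rewrite dhomogZ // -(dhomog_mf hf mf).
rewrite /= mdegE; elim/big_rec2: _ => [|i e p _ hp]; first exact: dhomog1.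
apply: dhomogM hp; rewrite tnth_mktuple.
suff /(dhomogMn (m i)) : \sum_j A i j *: 'X_j \is [in k[n], 1.-homog].
  by rewrite mul1n.
rewrite rpred_sum // => j _; rewrite dhomogZ // dhomogX.
by rewrite /= mdeg1.
Qed.

Lemma form_eval_delta f d i : f \is d.-homog ->
  form_eval f (delta_mx i 0) = f@_(U_(i) *+ d).
Proof.
move=> hf; rewrite {1}[f]mpolyE /form_eval raddf_sum /=.
have eval m : m \in msupp f ->
    (f@_m *: 'X_[m]).@[fun l => (delta_mx i 0 : 'cV[k]_n) l 0]
    = if m == (U_(i) *+ d)%MM then f@_(U_(i) *+ d) else 0.
  move=> mf; rewrite mevalZ mevalX.
  have [->|nm] := eqVneq m (U_(i) *+ d)%MM.
    rewrite big1 ?mulr1 // => l _.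
    rewrite mxE mulmnE mnm1E eqxx andbT [l == i]eq_sym.
    by have [_|_] := eqVneq i l; rewrite ?expr1n // mul0n.
  (* A monomial of degree [d] other than the pure power of ['X_i] involves another variable, which
     vanishes at the i-th coordinate point. *)
  have [l nli nz_ml] : exists2 l, l != i & (m l != 0)%N.
    apply/exists_inP; apply: contraNT nm => /exists_inPn m0.
    have mi : m i = d.
      rewrite -(dhomog_mf hf mf) /= mdegE (bigD1 i) //= big1 ?addn0 // => l nli.
      by apply/eqP; have := m0 l nli; rewrite negbK.
    apply/eqP/mnmP=> l; rewrite mulmnE mnm1E.
    have [<-|nil] := eqVneq i l; first by rewrite mul1n.
    apply/eqP; rewrite mul0n -[_ == _]negbK.
    by have := m0 l; rewrite unfold_in eq_sym nil; apply.
  by rewrite (bigD1 l) //= mxE (negPf nli) expr0n (negPf nz_ml) mul0r mulr0.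
rewrite big_seq (eq_bigr _ eval) -big_seq.
have [mf|nmf] := boolP ((U_(i) *+ d)%MM \in msupp f).
  rewrite (bigD1_seq _ mf (msupp_uniq f)) /= eqxx big1 ?addr0 // => m.
  by move/negPf->.
rewrite big1_seq ?memN_msupp_eq0 // => m /= mf.
by case: eqP => // Em; rewrite -Em mf in nmf.
Qed.

Lemma mderiv_homog f d i : f \is d.+1.-homog -> f^`M(i) \is d.-homog.
Proof.
move=> hf; apply/dhomogP=> m; rewrite mcoeff_msupp mcoeff_deriv => nz.
have mf : (m + U_(i))%MM \in msupp f.
  by rewrite mcoeff_msupp; apply: contraNneq nz => ->; rewrite mul0rn.
have /= := dhomog_mf hf mf.
by rewrite mdegD mdeg1 addn1 => -[].
Qed.

(** If the i-th coordinate point is off the hypersurface, the pure power of ['X_i] occurs and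
    [j = i] works. Otherwise some partial derivative is nonzero there, and its pure power of ['X_i]
    comes from the required monomial. *)
Lemma nonsingular_form_monomial f d i : nonsingular_form f ->
  f \is d.+1.-homog -> exists j, f@_(U_(i) *+ d + U_(j)) != 0.
Proof.
move=> [_ smooth_f] hf.
have [f0|nz] := eqVneq (form_eval f (delta_mx i 0)) 0; last first.
  by exists i; move: nz; rewrite (form_eval_delta _ hf) mulmS addmC.
have nz_e : delta_mx i 0 != 0 :> 'cV[k]_n.
  apply/eqP => /matrixP/(_ i 0)/eqP; rewrite !mxE !eqxx.
  by rewrite oner_eq0.
have [j] := smooth_f _ nz_e f0; rewrite (form_eval_delta _ (mderiv_homog j hf)).
rewrite mcoeff_deriv => nz; exists j.
by apply: contraNneq nz => ->; rewrite mul0rn.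
Qed.

Lemma diag_invariant_monomial f (d : 'rV[k]_n) e i j :
  form_subst f (diag_mx d) = f -> f@_(U_(i) *+ e + U_(j)) != 0 ->
  d 0 i ^+ e * d 0 j = 1.
Proof.
move=> /(congr1 (mcoeff (U_(i) *+ e + U_(j))%MM)).
rewrite mcoeff_subst_diag => fd nz.
apply: (mulIf nz); rewrite mul1r -{}[RHS]fd; congr (_ * _).
under eq_bigr do rewrite mnmDE mulmnE !mnm1E exprD.
rewrite big_split /=; congr (_ * _).
  rewrite (bigD1 i) //= big1 ?eqxx ?mul1n ?mulr1 // => l nli.
  by rewrite eq_sym (negPf nli) mul0n.
rewrite (bigD1 j) //= big1 ?eqxx ?mulr1 // => l nli.
by rewrite eq_sym (negPf nli).
Qed.

End Forms.

(** * Roots of unity linked by a self-map of the indices *)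

Lemma expr_gcdn_eq1 (k : fieldType) (z : k) n a b :
  (0 < n)%N -> z ^+ n = 1 -> z ^+ a = z ^+ b -> z ^+ gcdn n (b - a) = 1.
Proof.
move=> n_gt0 zn1 zab; have [m prim_z m_n] := prim_order_exists n_gt0 zn1.
apply/eqP; rewrite -(prim_order_dvd prim_z) dvdn_gcd m_n /=.
(* Subtraction is truncated: for [b < a] the difference is 0, which every order divides. *)
have [le_ab|/ltnW/eqP->] := leqP a b; last exact: dvdn0.
have nz_z : z != 0.
  apply: contra_eq_neq zn1 => ->.
  by rewrite expr0n gtn_eqF // eq_sym oner_neq0.
rewrite (prim_order_dvd prim_z); apply/eqP/(mulfI (expf_neq0 a nz_z)).
by rewrite -exprD subnKC // mulr1.
Qed.

Section CubicChain.
Variables (k : fieldType) (s : 'I_4 -> 'I_4).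

(* The powers of -3 modulo 25. *)
Let e m := nth 0%N [:: 1; 22; 9; 23; 6]%N m.

(** One of the two truncated differences is 0, so their sum is the absolute difference of the
    exponents. *)
Let expr_gcd_e (z : k) a b : z ^+ 25 = 1 -> z ^+ e a = z ^+ e b ->
  z ^+ gcdn 25 ((e a - e b) + (e b - e a)) = 1.
Proof.
move=> z1 zab; have [/eqP ab|/ltnW/eqP ba] := leqP (e a) (e b).
  by rewrite ab add0n; apply: expr_gcdn_eq1 zab.
by rewrite ba addn0; apply: expr_gcdn_eq1 (esym zab).
Qed.

Let chainE (d : 'I_4 -> k) i m : (forall j, d j ^+ 25 = 1) ->
  (forall j, d j ^+ 3 * d (s j) = 1) -> (m <= 4)%N ->
  d (iter m s i) = d i ^+ e m.
Proof.
(* The inverse cube is the 22nd power, since [3 + 22 = 25]. *)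
move=> d25 ds; have step j : d (s j) = d j ^+ 22.
  have nz : d j ^+ 3 != 0.
    by apply: contra_eq_neq (ds j) => ->; rewrite mul0r eq_sym oner_neq0.
  by apply: (mulfI nz); rewrite ds -exprD d25.
have red a b : d i ^+ (b + 25 * a) = d i ^+ b.
  by rewrite exprD exprM d25 expr1n mulr1.
elim: m => [|m IHm] lem; first by rewrite expr1.
rewrite iterS step IHm 1?ltnW // -exprM.
case: m lem {IHm} => [|[|[|[|//]]]] _ //.
- by rewrite -[(_ * _)%N]/(9 + 25 * 19)%N red.
- by rewrite -[(_ * _)%N]/(23 + 25 * 7)%N red.
- by rewrite -[(_ * _)%N]/(6 + 25 * 20)%N red.
Qed.

(* If some s-orbit is all of 'I_4, the family d is determined by its value at
   the starting point of that orbit; otherwise each orbit repeats an element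
   within its first 4 terms, and then d is constantly 1. *)
Lemma cubic_chain_determined (T : Type) (Q : T -> Prop) (d : T -> 'I_4 -> k) :
  (forall x, Q x -> forall j, d x j ^+ 25 = 1) ->
  (forall x, Q x -> forall j, d x j ^+ 3 * d x (s j) = 1) ->
  exists i, (forall x, Q x -> d x i ^+ 5 = 1) /\
    (forall x y, Q x -> Q y -> d x i = d y i -> d x =1 d y).
Proof.
move=> d25 ds; have dE x i m Qx := @chainE (d x) i m (d25 x Qx) (ds x Qx).
have [/existsP[i /injectiveP inj_i]|] :=
    boolP [exists i, injectiveb (fun m : 'I_4 => iter m s i)].
  have surj_i j : exists m : 'I_4, iter m s i = j.
    by have [g _ gK] := injF_bij inj_i; exists (g j).
  exists i; split=> [x Qx | x y Qx Qy dxy j]; last first.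
    have [m <-] := surj_i j.
    by rewrite !dE // 1?ltnW ?ltn_ord // dxy.
  (* The fourth iterate returns to some earlier index [m]. For [m = 0] the exponents differ by 5;
     for [m] = 1, 2, 3 they differ by 16, 3, 17, all prime to 5, so the value is even 1. *)
  have [m sm] := surj_i (iter 4 s i).
  have /expr_gcd_e : d x i ^+ e 4 = d x i ^+ e m.
    by rewrite -!dE ?sm // ltnW.
  move=> /(_ (d25 _ Qx _)); case: m {sm} => [[|[|[|[|//]]]]] /= _ => [//|||];
    by rewrite expr1 => ->; rewrite expr1n.
rewrite negb_exists => /forallP noinj.
have d1 x : Q x -> d x =1 fun=> 1.
  move=> Qx i; have /injectivePn[a [b ne_ab sab]] := noinj i.
  have /expr_gcd_e : d x i ^+ e a = d x i ^+ e b.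
    by rewrite -!dE ?sab // 1?ltnW ?ltn_ord.
  move=> /(_ (d25 _ Qx _)); move: ne_ab {sab}; rewrite -val_eqE /=.
  (* The numbers 1, 22, 9, 23 differ pairwise by integers prime to 5, so the gcd with 25 is always
     1. *)
  case: a b => [[|[|[|[|//]]]]] /= _ [[|[|[|[|//]]]]] //= _ _;
    by rewrite expr1.
exists ord0; split=> [x Qx|x y Qx Qy _ j]; first by rewrite d1 ?expr1n.
by rewrite !d1.
Qed.

End CubicChain.

(** * Lifting projective automorphisms to matrices *)

Lemma GLmxX (k : fieldType) n (A : GL k n) m :
  ((A ^+ m)%g : 'M_n) = (A : 'M_n) ^+ m.
Proof. by elim: m => // m IHm; rewrite expgS exprS /= IHm. Qed.

Lemma PGL_classX (k : fieldType) n (A : GL k n) m :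
  PGL_class (A ^+ m)%g = (PGL_class A ^+ m)%g.
Proof. by elim: m => // m IHm; rewrite !expgS PGL_classM IHm. Qed.

Lemma form_substX (k : fieldType) n (f : {mpoly k[n]}) (A : 'M_n) c m :
  form_subst f A = c *: f -> form_subst f (A ^+ m) = c ^+ m *: f.
Proof.
move=> fA; elim: m => [|m IHm]; first by rewrite scale1r form_subst1.
by rewrite exprSr -mulmxE form_substM IHm form_substZ fA scalerA exprSr.
Qed.

Lemma closed_field_root (k : closedFieldType) (c : k) m :
  (0 < m)%N -> exists z, z ^+ m = c.
Proof.
case: m => // m _.
have [z] := @solve_monicpoly k m.+1 (fun i => c *+ (i == 0%N)) isT.
rewrite big_ord_recl /= big1 => [|i _]; last by rewrite mul0r.
by rewrite expr0 mulr1 addr0; exists z.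
Qed.

(** A representative is rescaled twice. The factor [mu] makes its m-th power 1; the form is then
    multiplied by some [b] with [b ^+ m = 1]. A further factor [b ^+ v] keeps the m-th power and
    turns [b] into [b ^+ (v * d).+1], which is 1 for the [v] of a Bezout relation
    [u * m - v * d = 1]. *)
Lemma Paut_lift (k : closedFieldType) n (f : {mpoly k[n.+1]}) d m x :
  f \is d.-homog -> f != 0 -> (0 < m)%N -> coprime m d ->
  Paut f x -> (x ^+ m)%g = 1%g ->
  exists A : GL k n.+1,
    [/\ PGL_class A = x, (A : 'M_n.+1) ^+ m = 1 & form_subst f A = f].
Proof.
move=> hf nz_f m_gt0 co_md [A -> [c nz_c fA]].
rewrite -PGL_classX => /PGL_classP[s nz_s]; rewrite GLmxX /= => As.
have [mu mus] := closed_field_root s^-1 m_gt0.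
have scaleE (z : k) : z *: (A : 'M_n.+1) = A *m z%:M by rewrite mul_mx_scalar.
have fz (z : k) : form_subst f (z *: (A : 'M_n.+1)) = (z ^+ d * c) *: f.
  rewrite scaleE form_substM fA form_substZ (form_subst_scalar _ hf).
  by rewrite scalerA mulrC.
have ms : (mu *: (A : 'M_n.+1)) ^+ m = 1.
  by rewrite exprZn As scalerA mus mulVf // scale1r.
pose b := mu ^+ d * c; have b1 : b ^+ m = 1.
  apply/eqP; rewrite -subr_eq0.
  have := form_substX m (fz mu); rewrite ms form_subst1 -/b => /eqP.
  rewrite -subr_eq0 -{1}[f]scale1r -scalerBl scaler_eq0 (negPf nz_f) orbF.
  by rewrite -opprB oppr_eq0.
have [[u v] /= uv] := coprimeP _ m_gt0 co_md.
pose z := b ^+ v * mu.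
have zA : z *: (A : 'M_n.+1) = b ^+ v *: (mu *: (A : 'M_n.+1)).
  by rewrite scalerA.
have zm : (z *: (A : 'M_n.+1)) ^+ m = 1.
  by rewrite zA exprZn ms -exprM mulnC exprM b1 expr1n scale1r.
have nz_z : z != 0.
  have nz_mu : mu != 0.
    apply: contra_eq_neq mus => ->.
    by rewrite expr0n gtn_eqF // eq_sym invr_eq0.
  by rewrite mulf_neq0 ?expf_neq0 // mulf_neq0 ?expf_neq0.
have uzA : z *: (A : 'M_n.+1) \in unitmx by rewrite unitmxZ ?unitfE ?GLmx_unit.
exists (MkGL uzA); split=> //; first by apply/PGL_classP; exists z.
rewrite /= fz exprMn -mulrA -/b -exprM -exprSr.
have -> : (v * d).+1 = (u * m)%N.
  have lt_vu : (v * d < u * m)%N by rewrite -subn_gt0 uv.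
  by rewrite -[RHS](subnKC (ltnW lt_vu)) uv addn1.
by rewrite mulnC exprM b1 expr1n scale1r.
Qed.

(** The lifts commute up to a scalar [c]. Determinants give [c ^+ n.+1 = 1], moving [A ^+ m = 1]
    past [B] gives [c ^+ m = 1], and the two exponents are coprime. *)
Lemma PGL_commute_lift (k : fieldType) n (A B : GL k n.+1) m :
  (0 < m)%N -> coprime m n.+1 -> (A : 'M_n.+1) ^+ m = 1 ->
  (PGL_class A * PGL_class B = PGL_class B * PGL_class A)%g ->
  comm_mx (A : 'M_n.+1) B.
Proof.
move=> m_gt0 co_mn Am; rewrite -[LHS]PGL_classM -[RHS]PGL_classM.
move=> /PGL_classP[c nz_c /= AB].
suff c1 : c = 1 by rewrite /comm_mx AB c1 scale1r.
have c_n : c ^+ n.+1 = 1.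
  have := congr1 determinant AB; rewrite detZ !det_mulmx [\det B * _]mulrC.
  rewrite -[LHS]mul1r => /esym/mulIf; apply.
  by rewrite mulf_neq0 // -unitfE -unitmxE GLmx_unit.
have ABX e : (A : 'M_n.+1) ^+ e *m B = c ^+ e *: (B *m (A : 'M_n.+1) ^+ e).
  elim: e => [|e IHe]; first by rewrite scale1r mul1mx mulmx1.
  rewrite exprS -mulmxE -mulmxA IHe -scalemxAr !mulmxA AB -scalemxAl scalerA.
  by rewrite exprSr.
have c_m : c ^+ m = 1.
  have := ABX m; rewrite Am mul1mx mulmx1 -{1}[GLmx B]scale1r => /eqP.
  rewrite -subr_eq0 -scalerBl scaler_eq0 => /orP[|/eqP B0].
    by rewrite subr_eq0 => /eqP.
  by have := GLmx_unit B; rewrite B0 unitmxE det0 unitr0.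
have := expr_gcdn_eq1 m_gt0 c_m (esym c_n : c ^+ 0 = c ^+ n.+1).
by rewrite subn0 (eqP co_mn).
Qed.

(** * Simultaneous diagonalization of matrices of finite order *)

(** The minimal polynomial divides ['X^m - 1], which splits over [k] and is separable because [m] is
    nonzero in [k]. *)
Lemma finite_order_diagonalizable (k : closedFieldType) n (A : 'M[k]_n.+1) m :
  m%:R != 0 :> k -> A ^+ m = 1 -> diagonalizable A.
Proof.
move=> nz_m Am; apply/diagonalizableP.
have [r Er] := closed_field_poly_normal ('X^m - 1 : {poly k}).
have m_gt0 : (0 < m)%N by case: m nz_m {Am Er} => //; rewrite eqxx.
have lc : lead_coef ('X^m - 1 : {poly k}) = 1.
  by apply/eqP; rewrite -monicE monicXnsubC.
rewrite lc scale1r in Er; exists r.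
  by rewrite -separable_prod_XsubC -Er separable_Xn_sub_1.
rewrite -Er mxminpoly_min // rmorphB rmorphXn /= horner_mx_X rmorph1 Am.
exact: subrr.
Qed.

Lemma diag_mxX (k : fieldType) n (d : 'rV[k]_n) m :
  diag_mx d ^+ m = diag_mx (\row_i d 0 i ^+ m).
Proof.
elim: m => [|m IHm].
  rewrite expr0 -[1]diag_const_mx; congr diag_mx.
  by apply/rowP=> i; rewrite !mxE.
rewrite exprS IHm -mulmxE mulmx_diag; congr diag_mx.
by apply/rowP=> i; rewrite !mxE exprS.
Qed.

Lemma mxconjX (k : fieldType) n (P A : 'M[k]_n) m :
  P \in unitmx -> (P *m A *m invmx P) ^+ m = P *m A ^+ m *m invmx P.
Proof.
move=> uP; elim: m => [|m IHm]; first by rewrite !expr0 mulmx1 mulmxV.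
by rewrite !exprS IHm -!mulmxE !mulmxA mulmxKV.
Qed.

(** Finite choice of preimages, used to pick good matrix representatives of projective classes. *)
Lemma seq_lift (S T : eqType) (h : S -> T) (Q : S -> Prop) (s : seq T) :
  {in s, forall x, exists2 a, h a = x & Q a} ->
  exists2 l : seq S, map h l = s & {in l, forall a, Q a}.
Proof.
elim: s => [|x s IHs] sP; first by exists [::].
have [a ha Qa] := sP x (mem_head x s).
have [y ys|l hl Ql] := IHs; first by apply: sP; rewrite inE ys orbT.
exists (a :: l); first by rewrite /= ha hl.
by move=> b; rewrite inE => /predU1P[->|/Ql].
Qed.

Lemma fset_Paut_group (k : fieldType) n (f : {mpoly k[n]})
    (G : {fset PGL k n}) :
  (forall a, a \in G <-> Paut f a) ->
  (1 \in G)%g /\ {in G &, forall x y, x * y^-1 \in G}%g.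
Proof.
move=> hG; split=> [|x y /hG Gx /hG Gy]; first exact/hG/Paut1.
by apply/hG/PautM => //; apply: PautV.
Qed.

Lemma finite_order_codiagonalizable (k : closedFieldType) n m
    (l : seq 'M[k]_n.+1) :
  m%:R != 0 :> k -> {in l &, forall A B, comm_mx A B} ->
  {in l, forall A, A ^+ m = 1} ->
  exists2 P, P \in unitmx & exists d : 'M_n.+1 -> 'rV_n.+1,
    {in l, forall A, P *m A *m invmx P = diag_mx (d A)}.
Proof.
move=> nz_m comm_l lm.
have [|P uP /allP diagP] := (codiagonalizableP l).1.
  by split=> // A lA; apply: finite_order_diagonalizable nz_m (lm _ lA).
exists P => //; exists (fun A => \row_i (P *m A *m invmx P) i i) => A lA.
have /(diagonalizable_forP _ uP) dA := diagP A lA.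
apply/matrixP=> i j; have [->|nij] := eqVneq i j.
  by rewrite [RHS]mxE eqxx mulr1n [RHS]mxE.
by rewrite [RHS]mxE (negPf nij) mulr0n dA.
Qed.

Theorem proposition3p2 (k : closedFieldType) (hk : [pchar k] =i pred0)
  (f : {mpoly k[4]}) (hf : f \is 4.-homog) (hns : nonsingular_form f)
  (G : {fset PGL k 4}) (hG : forall a : PGL k 4, a \in G <-> Paut f a) :
  (logn 5 #|` G| <= 1)%N.
Proof.
rewrite leqNgt; apply/negP => lt1G.
have [s [uniq_s size_s sG comm_s s25]] :=
  abelian_p2subgroup (fset_Paut_group hG) (isT : prime 5) lt1G.
have [l ls lP] : exists2 l : seq (GL k 4), map PGL_class l = s &
    {in l, forall A : GL k 4, GLmx A ^+ 25 = 1 /\ form_subst f A = f}.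
  apply: seq_lift => x sx.
  have [||||A [? ? ?]] := Paut_lift (m := 25) (x := x) hf (proj1 hns) => //.
  - exact/hG/sG.
  - exact: (s25 x sx).
  - by exists A.
pose ms := [seq GLmx A | A <- l].
have [|||P uP [d dP]] := @finite_order_codiagonalizable k 3 25 ms.
- by rewrite ((pcharf0P k).1 hk).
- move=> _ _ /mapP[A lA ->] /mapP[B lB ->].
  apply: (PGL_commute_lift (m := 25)) => //; first by case: (lP A lA).
  by apply: comm_s; rewrite -ls map_f.
- by move=> _ /mapP[A lA ->]; case: (lP A lA).
have {}dP (A : GL k 4) : A \in l -> P *m A *m invmx P = diag_mx (d A).
  by move=> lA; apply/dP/map_f.
(* The form [f] in coordinates where every lift is diagonal. *)
pose g := form_subst f (invmx P).
have uP' : invmx P \in unitmx by rewrite unitmx_inv.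
have g_homog : g \is 4.-homog by apply: form_subst_homog.
have g_monomial i : exists j, g@_(U_(i) *+ 3 + U_(j)) != 0.
  exact: nonsingular_form_monomial (nonsingular_form_subst uP' hns) g_homog.
have gd A : A \in l -> form_subst g (diag_mx (d A)) = g.
  move=> lA; rewrite -dP // /g -form_substM !mulmxA mulVmx // mul1mx.
  by rewrite form_substM; case: (lP A lA) => _ ->.
have d25 A : A \in l -> forall i, d A 0 i ^+ 25 = 1.
  move=> lA i; have [A25 _] := lP A lA.
  have := mxconjX A 25 uP; rewrite dP // A25 mulmx1 mulmxV // diag_mxX.
  by move/matrixP/(_ i i); rewrite !mxE eqxx.
(* The map [s'] depends on [g] alone, so the same one serves all lifts. *)
have [s' sE] : exists s' : 'I_4 -> 'I_4,
    forall i, g@_(U_(i) *+ 3 + U_(s' i)) != 0.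
  exists (fun i => xchoose (g_monomial i)) => i.
  exact: (xchooseP (g_monomial i)).
have [|i [d5 d_inj]] := @cubic_chain_determined k s' _ (fun A => A \in l)
  (fun A => d A 0) d25.
  by move=> A lA j; apply: diag_invariant_monomial (gd A lA) (sE j).
(* The i-th diagonal entries are fifth roots of unity and tell the lifts apart, so there are at most
   5 of them, against the 25 classes in [s]. *)
have : (size [seq d A 0%R i | A : GL k 4 <- l] <= 5)%N.
  apply: max_unity_roots => //.
    by apply/allP=> _ /mapP[A lA ->]; apply/unity_rootP/d5.
  rewrite map_inj_in_uniq => [|A B lA lB dAB].
    by apply: (@map_uniq _ _ PGL_class); rewrite ls.
  apply: val_inj; have dd : d A = d B.
    by apply/rowP=> j; apply: d_inj dAB j.
  have := dP B lB; rewrite -dd -dP // => /(can_inj (mulmxKV uP)).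
  by move/(can_inj (mulKmx uP)).
by rewrite size_map -(size_map PGL_class) ls size_s.
Qed.
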